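(* $(\mathbb{R},<)$ is a total ordering; that is, the relation $<$ on $\mathbb{R}$ (the set of minimal rational Cauchy filters) is irreflexive, asymmetric and transitive, and for all $a,b\in\mathbb{R}$ with $a\neq b$ either $a<b$ or $b<a$.
   Context: For $q\in\mathbb{Q}$ and rational $\varepsilon>0$ let $q_\varepsilon=\{x\in\mathbb{Q}\mid q-\varepsilon<x<q+\varepsilon\}$. A (rational) filter is a non-empty collection $\mathcal{F}$ of subsets of $\mathbb{Q}$ closed under binary intersections and under supersets (in $\mathbb{Q}$); the improper filter $\mathcal{P}(\mathbb{Q})$ is allowed as a filter. A filter $\mathcal{F}$ is Cauchy if for every rational $\varepsilon>0$ there is $q\in\mathbb{Q}$ with $q_\varepsilon\in\mathcal{F}$. A minimal Cauchy filter is a Cauchy filter $\mathcal{F}$ such that any Cauchy filter $\mathcal{G}\subseteq\mathcal{F}$ satisfies $\mathcal{G}=\mathcal{F}$. In this statement $\mathbb{R}$ denotes the set of all minimal Cauchy filters in $\mathbb{Q}$, and its elements are called real numbers. For $A,B\subseteq\mathbb{Q}$ write $A<_\forall B$ if $\alpha<\beta$ for all $\alpha\in A$ and $\beta\in B$. For real numbers $a,b$, define $a<b$ to mean that there exist $A\in a$ and $B\in b$ with $A<_\forall B$. *)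

(* Defs.v *)
From HB Require Import structures.
From mathcomp Require Import all_boot all_order all_algebra.
From mathcomp Require Import boolp classical_sets filter.

Set Implicit Arguments.
Unset Strict Implicit.
Unset Printing Implicit Defensive.

Import Order.TTheory GRing.Theory Num.Theory.

Local Open Scope classical_set_scope.
Local Open Scope ring_scope.

Definition rat_ball (q e : rat) : set rat := [set x | q - e < x < q + e].

(* [Filter] does not require properness: it only asks for [setT] (equivalent to
   non-emptiness by upward closure), binary intersections and supersets. *)
Definition cauchy_filter (F : set_system rat) : Prop :=
  Filter F /\ forall e : rat, 0 < e -> exists q : rat, F (rat_ball q e).

Definition minimal_cauchy_filter (F : set_system rat) : Prop :=
  cauchy_filter F /\
  forall G : set_system rat, cauchy_filter G -> G `<=` F -> G = F.

Definition filter_real : Type := {F : set_system rat | minimal_cauchy_filter F}.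

Definition lt_forall (A B : set rat) : Prop :=
  forall x y : rat, A x -> B y -> x < y.

Definition real_lt (a b : filter_real) : Prop :=
  exists A B : set rat, [/\ sval a A, sval b B & lt_forall A B].

(* Main.v *)
(** Totality: if neither [a < b] nor [b < a], then for every [e] the balls of
    radius [e] belonging to [a] and to [b] have centres less than [2 * e] apart,
    so a common ball of radius [3 * e] lies in both. Hence [a `&` b] is again a
    Cauchy filter, and minimality of [a] and of [b] gives [a = a `&` b = b].
    The order axioms only use that minimal Cauchy filters are proper: the
    improper filter strictly contains the Cauchy filter of neighbourhoods of 0. *)
Require Import Defs.
From mathcomp Require Import all_boot all_order all_algebra.
From mathcomp Require Import lra.
From mathcomp Require Import boolp classical_sets filter.

Set Implicit Arguments.
Unset Strict Implicit.
Unset Printing Implicit Defensive.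

Import Order.TTheory GRing.Theory Num.Theory.

Local Open Scope classical_set_scope.
Local Open Scope ring_scope.

Lemma rat_ball_center (q e : rat) : 0 < e -> rat_ball q e q.
Proof. by move=> e0; rewrite /rat_ball /=; lra. Qed.

Definition rat_nbhs (q : rat) : set_system rat :=
  [set A | exists2 e : rat, 0 < e & rat_ball q e `<=` A].

Lemma cauchy_rat_nbhs (q : rat) : cauchy_filter (rat_nbhs q).
Proof.
split; last by move=> e e0; exists q, e.
split.
- by exists 1.
- move=> A B [d d0 dA] [e e0 eB]; exists (Num.min d e).
    by rewrite lt_min d0 e0.
  move=> x; rewrite /rat_ball /= => xde.
  have [dle|dle] := leP d e; rewrite ?(min_l dle) ?(min_r (ltW dle)) in xde.
    by split; [apply: dA|apply: eB]; rewrite /rat_ball /=; lra.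
  by split; [apply: dA|apply: eB]; rewrite /rat_ball /=; lra.
- by move=> A B AB [e e0 eA]; exists e => //; apply: subset_trans AB.
Qed.

(** An empty member would force every set into [F]; minimality would then identify [F] with
    [rat_nbhs 0], whose members all contain 0. *)
Lemma minimal_cauchy_proper {F : set_system rat} :
  minimal_cauchy_filter F -> ProperFilter F.
Proof.
move=> [[FF _] Fmin]; apply: Build_ProperFilter_ex => A FA.
apply: contrapT => /forallNP A0.
have F0 B : F B by apply: filterS FA => x /A0.
have [e e0] : rat_nbhs 0 set0.
  by rewrite (Fmin _ (cauchy_rat_nbhs 0)) => // B _; apply: F0.
by move=> /(_ 0); apply; apply: rat_ball_center.
Qed.

Lemma filter_real_setI_ex (a : filter_real) (A B : set rat) :
  sval a A -> sval a B -> exists x, A x /\ B x.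
Proof.
move=> aA aB; have aP := minimal_cauchy_proper (svalP a).
exact: (filter_ex (filterI aA aB)).
Qed.

(** A ball must lie in both filters at once to lie in their intersection, so one centre has to serve
    both. *)
Lemma cauchy_filterI (F G : set_system rat) :
  Filter F -> Filter G ->
  (forall e : rat, 0 < e -> exists q, F (rat_ball q e) /\ G (rat_ball q e)) ->
  cauchy_filter (F `&` G).
Proof.
move=> FF GG FGball; split => //; split.
- by split; apply: filterT.
- by move=> A B [FA GA] [FB GB]; split; apply: filterI.
- by move=> A B AB [FA GA]; split; apply: filterS AB _.
Qed.

Lemma minimal_cauchy_eq (F G : set_system rat) :
  minimal_cauchy_filter F -> minimal_cauchy_filter G ->
  (forall e : rat, 0 < e -> exists q, F (rat_ball q e) /\ G (rat_ball q e)) ->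
  F = G.
Proof.
move=> [[FF _] Fmin] [[GF _] Gmin] /(cauchy_filterI FF GF) FGC.
by rewrite -(Fmin _ FGC (@subIsetl _ _ _)) (Gmin _ FGC (@subIsetr _ _ _)).
Qed.

(** If [p + e <= q - e], this gap separates the two open balls, even when the endpoints coincide. *)
Lemma not_lt_forall_rat_ball (p q e : rat) :
  ~ lt_forall (rat_ball p e) (rat_ball q e) -> q - p < e + e.
Proof.
move=> npq; rewrite ltNge; apply/negP => epq; apply: npq => x y.
by rewrite /rat_ball /= => xp yq; lra.
Qed.

Lemma rat_ball_subset (p q d e : rat) :
  p - d <= q - e -> q + e <= p + d -> rat_ball q e `<=` rat_ball p d.
Proof. by move=> l r x; rewrite /rat_ball /=; lra. Qed.

Lemma real_lt_irrefl (a : filter_real) : ~ real_lt a a.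
Proof.
move=> [A [B [aA aB AB]]].
have [x [Ax Bx]] := filter_real_setI_ex aA aB.
by have := AB _ _ Ax Bx; rewrite ltxx.
Qed.

Lemma real_lt_trans (a b c : filter_real) :
  real_lt a b -> real_lt b c -> real_lt a c.
Proof.
move=> [A [B [aA bB AB]]] [B' [C [bB' cC BC]]]; exists A, C; split=> // x z Ax Cz.
have [y [By B'y]] := filter_real_setI_ex bB bB'.
exact: lt_trans (AB _ _ Ax By) (BC _ _ B'y Cz).
Qed.

Lemma real_lt_total (a b : filter_real) : a <> b -> real_lt a b \/ real_lt b a.
Proof.
case: a b => [F Fm] [G Gm] FG; apply: contrapT => /not_orP[nFG nGF].
(* By proof irrelevance, it is enough to equate the underlying filters. *)
apply: FG; apply: eq_exist; apply: minimal_cauchy_eq => // e e0.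
have [[[FF FC] _] [[GF GC] _]] := (Fm, Gm).
(* With centres less than [2 * e / 3] apart, a ball of radius [e / 3] around [q] stays within [e] of
   [p]. *)
have e30 : 0 < e / 3 by lra.
have [[p Fp] [q Gq]] := (FC _ e30, GC _ e30).
have pq : q - p < e / 3 + e / 3.
  apply: not_lt_forall_rat_ball => pq; apply: nFG.
  by exists (rat_ball p (e / 3)), (rat_ball q (e / 3)).
have qp : p - q < e / 3 + e / 3.
  apply: not_lt_forall_rat_ball => qp; apply: nGF.
  by exists (rat_ball q (e / 3)), (rat_ball p (e / 3)).
(* The choice of [p] is arbitrary: [q] would serve equally well, by symmetry. *)
exists p; split.
- by apply: filterS Fp; apply: rat_ball_subset; lra.
- by apply: filterS Gq; apply: rat_ball_subset; lra.
Qed.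

Theorem theorem4p6 :
  [/\ forall a : filter_real, ~ real_lt a a,
      forall a b : filter_real, real_lt a b -> ~ real_lt b a,
      forall a b c : filter_real, real_lt a b -> real_lt b c -> real_lt a c
    & forall a b : filter_real, a <> b -> real_lt a b \/ real_lt b a].
Proof.
split.
- exact: real_lt_irrefl.
- by move=> a b ab ba; apply: (@real_lt_irrefl a); apply: real_lt_trans ba.
- exact: real_lt_trans.
- exact: real_lt_total.
Qed.
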